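(* Let $G$ be a graph on the vertex set $\{x_1,\dots,x_n\}$ satisfying one of the following: (a) $G^c$ is a block graph; (b) $G^c$ is a proper interval graph; (c) $G$ is cochordal and every vertex of $G$ belongs to at most two maximal independent sets of $G$. Then for any assignment of positive integers $k_A$ to the facets $A\in\mathcal{F}(\Delta_G)$, the ideal $\bigcap_{A\in\mathcal{F}(\Delta_G)}P_{[n]\setminus A}^{k_A}$ is componentwise linear. In particular, $I(G)^{(k)}$ is componentwise linear for all $k\ge1$.
   Context: $S=K[x_1,\dots,x_n]$, vertices $x_i$ identified with indices $i\in[n]$. For $B\subseteq[n]$, $P_B=(x_i:i\in B)$. $G^c$ is the complement graph. $G$ is chordal if it has no induced cycle of length $>3$; cochordal if $G^c$ is chordal. A cut vertex of a connected graph is a vertex whose removal disconnects it; a block is a maximal connected induced subgraph without cut vertex; a block graph is a graph all of whose blocks are cliques. A proper interval graph is a graph admitting a labeling $x_1,\dots,x_n$ of its vertices such that for all $i<j<k$, $\{x_i,x_k\}\in E$ implies $\{x_i,x_j\},\{x_j,x_k\}\in E$. An independent set is a set of pairwise non-adjacent vertices; $\Delta_G$ is the simplicial complex of independent sets of $G$, and $\mathcal{F}(\Delta_G)$ its set of facets (maximal independent sets). $I(G)=(x_ix_j:\{x_i,x_j\}\in E(G))$ and $I(G)^{(k)}=\bigcap_{A\in\mathcal{F}(\Delta_G)}P_{[n]\setminus A}^k$. A homogeneous ideal $I$ is componentwise linear if for every $d$ the ideal $I_{\langle d\rangle}$ generated by the homogeneous elements of degree $d$ in $I$ has a linear resolution.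 *)

(* Defs.v *)
From HB Require Import structures.
From mathcomp Require Import all_boot all_algebra.
From mathcomp Require Import fingroup perm.
From mathcomp Require Import mpoly.

Set Implicit Arguments.
Unset Strict Implicit.
Unset Printing Implicit Defensive.

Import GRing.Theory.
Local Open Scope ring_scope.

Definition simple_graph (n : nat) (G : rel 'I_n) : Prop :=
  ssrbool.irreflexive G /\ ssrbool.symmetric G.

Definition compl_graph (n : nat) (G : rel 'I_n) : rel 'I_n :=
  fun x y => (x != y) && ~~ G x y.

Definition independent (n : nat) (G : rel 'I_n) (A : {set 'I_n}) : bool :=
  [forall x in A, forall y in A, ~~ G x y].

Definition facet (n : nat) (G : rel 'I_n) (A : {set 'I_n}) : bool :=
  independent G A &&
  [forall B : {set 'I_n}, (A \proper B) ==> ~~ independent G B].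

(* the induced subgraph G[B] is connected (the empty graph counts as connected) *)
Definition induced_connected (n : nat) (G : rel 'I_n) (B : {set 'I_n}) : bool :=
  [forall x in B, forall y in B,
     connect [rel u v | [&& u \in B, v \in B & G u v]] x y].

Definition biconn (n : nat) (G : rel 'I_n) (B : {set 'I_n}) : bool :=
  induced_connected G B && [forall v in B, induced_connected G (B :\ v)].

Definition block (n : nat) (G : rel 'I_n) (B : {set 'I_n}) : bool :=
  [&& B != set0, biconn G B &
      [forall C : {set 'I_n}, (B \proper C) ==> ~~ biconn G C]].

Definition clique (n : nat) (G : rel 'I_n) (B : {set 'I_n}) : bool :=
  [forall x in B, forall y in B, (x != y) ==> G x y].

Definition block_graph (n : nat) (G : rel 'I_n) : Prop :=
  forall B : {set 'I_n}, block G B -> clique G B.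

Definition induced_cycle (n k : nat) (G : rel 'I_n) (f : 'I_k -> 'I_n) : Prop :=
  injective f /\
  forall i j : 'I_k,
    G (f i) (f j) = ((j == (i.+1 %% k)%N :> nat) || (i == (j.+1 %% k)%N :> nat)).

Definition chordal (n : nat) (G : rel 'I_n) : Prop :=
  forall (k : nat) (f : 'I_k -> 'I_n), (3 < k)%N -> ~ induced_cycle G f.

Definition cochordal (n : nat) (G : rel 'I_n) : Prop :=
  chordal (compl_graph G).

Definition proper_interval (n : nat) (G : rel 'I_n) : Prop :=
  exists s : {perm 'I_n},
    forall i j k : 'I_n, (i < j)%N -> (j < k)%N ->
      G (s i) (s k) -> G (s i) (s j) && G (s j) (s k).

Section Ideals.
Variables (K : fieldType) (n : nat).
Local Notation S := {mpoly K[n]}.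

(* homogeneous of (standard) degree d; 0 is homogeneous of every degree *)
Definition homog_deg (d : nat) (p : S) : bool := p \is ishomog1 d mdeg.

Definition ideal_gen (Gen : S -> Prop) : S -> Prop :=
  fun p => exists s : seq (S * S),
    (forall q, q \in s -> Gen q.2) /\ p = \sum_(q <- s) q.1 * q.2.

Fixpoint ideal_pow (I : S -> Prop) (k : nat) : S -> Prop :=
  match k with
  | 0 => fun _ => True
  | k'.+1 => ideal_gen (fun q => exists a b, ideal_pow I k' a /\ I b /\ q = a * b)
  end.

Definition primeP (B : {set 'I_n}) : S -> Prop :=
  ideal_gen (fun q => exists2 i, i \in B & q = 'X_i).

Definition ideal_deg (I : S -> Prop) (d : nat) : S -> Prop :=
  ideal_gen (fun q => I q /\ homog_deg d q).

(* J has a d-linear (graded free) resolution: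
     0 <- J <- F_0 <- F_1 <- ... <- F_m = 0,  F_i = S(-d-i)^(b i),
   i.e. F_0 -> J given by generators g of degree d, and each differential
   F_{i+1} -> F_i given by a matrix of linear forms (v |-> v *m D i);
   the complex is exact and finite. *)
Definition has_linear_resolution (J : S -> Prop) (d : nat) : Prop :=
  exists (b : nat -> nat) (m : nat) (g : 'cV[S]_(b 0))
         (D : forall i : nat, 'M[S]_(b i.+1, b i)),
    [/\ b m = 0%N,
        (forall j, homog_deg d (g j 0)) /\ (forall i r c, homog_deg 1 (D i r c)),
        (forall p, J p <-> exists v : 'rV[S]_(b 0), p = (v *m g) 0 0),
        (forall v : 'rV[S]_(b 0), v *m g = 0 <-> exists w : 'rV[S]_(b 1), v = w *m D 0%N) &
        (forall i (v : 'rV[S]_(b i.+1)),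
            v *m D i = 0 <-> exists w : 'rV[S]_(b i.+2), v = w *m D i.+1)].

Definition componentwise_linear (I : S -> Prop) : Prop :=
  forall d : nat, has_linear_resolution (ideal_deg I d) d.

Definition facet_intersection (G : rel 'I_n) (k : {set 'I_n} -> nat) : S -> Prop :=
  fun p => forall A : {set 'I_n}, facet G A -> ideal_pow (primeP (~: A)) (k A) p.

Definition symbolic_power (G : rel 'I_n) (k : nat) : S -> Prop :=
  facet_intersection G (fun _ => k).

End Ideals.

(* Main.v *)
(* Write H for the complement of G.  The facets are the maximal cliques of H, and
   a monomial x^a lies in the intersection iff sum_(i notin A) a_i >= k_A for
   every maximal clique A of H.  Call an ordering of the vertices good if, for
   each vertex t, the sets {x in A | x > t}, for A a maximal clique containing t,
   form a chain.  For a good ordering the degree d monomials of the ideal, listed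
   lexicographically, have linear quotients: if a <_lex b first differ at t, then
   each constraint A that is tight at a and contains t has some s > t in A with
   a_s > b_s; taking s for the smallest such A makes x^a x_t / x_s feasible.
   Linear quotients give a linear resolution by iterated mapping cones.
   The defining labelling of a proper interval graph is good, since its maximal
   cliques are intervals.  In the other two cases H is chordal and any perfect
   elimination ordering is good: the later neighbours of t together with t lie in
   a single maximal clique A0, and any other maximal clique through t either meets
   A0 only in t (block graphs) or is the only one besides A0 (case (c)). *)
Require Import Defs.
From HB Require Import structures.
From mathcomp Require Import all_boot all_algebra.
From mathcomp Require Import fingroup perm.
From mathcomp Require Import mpoly zify.

Set Implicit Arguments.
Unset Strict Implicit.
Unset Printing Implicit Defensive.

Import GRing.Theory.
Local Open Scope ring_scope.

(** * Linear resolutions and mapping cones *)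

Section LinearResolutions.
Variables (K : fieldType) (n : nat).
Local Notation S := {mpoly K[n]}.

Definition homog_mx (d b c : nat) (M : 'M[S]_(b, c)) : Prop :=
  forall i j, homog_deg d (M i j).

Definition syzygies (a b c : nat) (D : 'M[S]_(a, b)) (M : 'M[S]_(b, c)) : Prop :=
  forall v : 'rV_b, v *m M = 0 <-> exists w : 'rV_a, v = w *m D.

(** A free resolution of the row kernel of [M] by matrices of linear forms, reaching a zero module
    after [m] steps. The recursion exposes the first differential, as the mapping cone induction
    requires. *)
Fixpoint linear_syzygies (m b c : nat) (M : 'M[S]_(b, c)) : Prop :=
  if m is m'.+1 then
    exists (a : nat) (D : 'M[S]_(a, b)),
      [/\ homog_mx 1 D, syzygies D M & linear_syzygies m' D]
  else b = 0%N.

Lemma syzygies0 (M0 : 'M[S]_(0, 0)) c (M : 'M[S]_(0, c)) : syzygies M0 M.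
Proof.
move=> v; split=> _; first by exists 0; rewrite !thinmx0.
by rewrite (thinmx0 v) mul0mx.
Qed.

Lemma linear_syzygiesS m b c (M : 'M[S]_(b, c)) :
  linear_syzygies m M -> linear_syzygies m.+1 M.
Proof.
elim: m b c M => [|m IH] b c M.
  move=> /= b0; subst b; exists 0%N, 0; split=> //; first by case.
  exact: syzygies0.
by move=> [a [D [hD sD /IH lD]]]; exists a, D.
Qed.

Lemma linear_syzygies_leq m m' b c (M : 'M[S]_(b, c)) :
  (m <= m')%N -> linear_syzygies m M -> linear_syzygies m' M.
Proof.
move=> /subnKC <-; elim: (m' - m)%N => [|k IH]; first by rewrite addn0.
by move=> /IH; rewrite addnS; apply: linear_syzygiesS.
Qed.

Lemma pihomogM d k (p g : S) :
  homog_deg d g -> pihomog mdeg (k + d) (p * g) = pihomog mdeg k p * g.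
Proof.
move=> hg; rewrite {1}(pihomog_partitionE (leqnn (mmeasure mdeg p))).
rewrite mulr_suml raddf_sum /=.
have E (i : nat) : pihomog mdeg (k + d) (pihomog mdeg i p * g) =
    if i == k then pihomog mdeg k p * g else 0.
  have hi : pihomog mdeg i p * g \is (i + d).-homog.
    by apply: dhomogM => //; apply: pihomogP.
  have [<-|ne] := eqVneq i k; first exact: pihomog_dE.
  by apply: pihomog_ne0 hi; rewrite eqn_add2r.
under eq_bigr => i _ do rewrite E.
have [lt|le] := ltnP k (mmeasure mdeg p).
  by rewrite (bigD1 (Ordinal lt)) //= eqxx big1 ?addr0 // => i /negbTE; rewrite -val_eqE /= => ->.
(* Here [k] exceeds every degree occurring in [p]: no summand has index [k], and the degree [k]
   component of [p] vanishes too. *)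
rewrite big1.
  rewrite pihomogE big1_seq ?mul0r // => m /andP[/eqP mk] /mmeasure_mnm_lt lt.
  by have := leq_trans (lt mdeg) le; rewrite mk ltnn.
by move=> i _; case: eqP => // ei; move: (ltn_ord i); rewrite ei ltnNge le.
Qed.

(** By degree, only the linear components of the coefficients contribute. This allows comparison
    maps to be chosen with linear entries. *)
Lemma homog_factor d b c (M : 'M[S]_(b, c)) (u : 'rV[S]_c) (v : 'rV[S]_b) :
  homog_mx d M -> homog_mx d.+1 u -> u = v *m M ->
  exists2 w : 'rV[S]_b, homog_mx 1 w & u = w *m M.
Proof.
move=> hM hu e; exists (map_mx (pihomog mdeg 1) v) => [i j|].
  by rewrite mxE; apply: pihomogP.
apply/rowP=> j; rewrite -[LHS](pihomog_dE (d := d.+1) (mf := mdeg)); last exact: hu.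
rewrite e !mxE raddf_sum; apply: eq_bigr => k _.
rewrite !mxE; exact: (pihomogM 1).
Qed.

Lemma homog_mulmx d e a b c (D : 'M[S]_(a, b)) (M : 'M[S]_(b, c)) :
  homog_mx e D -> homog_mx d M -> homog_mx (e + d) (D *m M).
Proof.
move=> hD hM i j; rewrite /homog_deg mxE; apply: rpred_sum => k _.
by apply: dhomogM; [apply: hD|apply: hM].
Qed.

Lemma homog_lift d a b c (N : 'M[S]_(a, c)) (M : 'M[S]_(b, c)) :
  homog_mx d M -> homog_mx d.+1 N ->
  (forall i, exists v : 'rV[S]_b, row i N = v *m M) ->
  exists2 E : 'M[S]_(a, b), homog_mx 1 E & N = E *m M.
Proof.
move=> hM hN hspan.
have /fin_all_exists2 [f f1 f2] : forall i, exists2 w : 'rV[S]_b,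
    homog_mx 1 w & row i N = w *m M.
  move=> i; case: (hspan i) => v /homog_factor; apply=> //.
  by move=> k j; rewrite mxE; apply: hN.
exists (\matrix_i f i); first by move=> i j; rewrite mxE; apply: f1.
by apply/row_matrixP=> i; rewrite row_mul rowK f2.
Qed.

(* The mapping cone: [D'] presents the quotient of the row span of
   [col_mx M M'] by that of [M], and [E] is the comparison map. *)
Lemma linear_syzygies_cone m d b b' a' c
    (M : 'M[S]_(b, c)) (M' : 'M[S]_(b', c)) (D' : 'M[S]_(a', b')) :
  homog_mx d M -> homog_mx d M' -> homog_mx 1 D' ->
  linear_syzygies m.+1 M -> linear_syzygies m D' ->
  (forall v : 'rV[S]_b', (exists u : 'rV[S]_b, v *m M' = u *m M) <->
                         exists w : 'rV[S]_a', v = w *m D') ->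
  linear_syzygies m.+1 (col_mx M M').
Proof.
elim: m d b b' a' c M M' D' => [|m IH] d b b' a' c M M' D' hM hM' hD'.
  move=> [a [D [hD sD a0]]] a0' colon; move: a0 a0' => /= a0 a0'; subst a a'.
  exists 0%N, 0; split=> //; first by case.
  move=> v; rewrite -[v]hsubmxK mul_row_col; split.
    move=> e.
    have [|w ew] := (colon (rsubmx v)).1.
      by exists (- lsubmx v); rewrite mulNmx; apply/eqP; rewrite -addr_eq0 addrC e.
    have z : rsubmx v = 0 by rewrite ew (thinmx0 w) mul0mx.
    move: e; rewrite z mul0mx addr0 => /sD[w' ->].
    by exists 0; rewrite (thinmx0 w') !mul0mx row_mx0.
  move=> [w]; rewrite (thinmx0 w) mul0mx -[0]row_mx0 => /eq_row_mx[-> ->].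
  by rewrite !mul0mx addr0.
move=> [a [D [hD sD lD]]] lD' colon.
(* By [colon], the rows of [D' *m M'] lie in the row span of [M]; the lift can be taken linear by
   degree. *)
have [E0 hE0 eE0] : exists2 E0, homog_mx 1 E0 & D' *m M' = E0 *m M.
  apply: (@homog_lift d) => //; first by rewrite -add1n; apply: homog_mulmx.
  move=> i; rewrite row_mul; apply/colon; exists (delta_mx 0 i).
  by rewrite rowE.
(* With this sign the rows of [row_mx E D'] are syzygies of [col_mx M M']. *)
pose E := - E0.
have hE : homog_mx 1 E by move=> i j; rewrite /homog_deg mxE dhomogN; apply: hE0.
have eE : E *m M + D' *m M' = 0 by rewrite mulNmx eE0 addNr.
exists (a + a')%N, (col_mx (row_mx D 0) (row_mx E D')); split.
- move=> i j; rewrite /homog_deg mxE; case: splitP => k _; rewrite mxE; case: splitP => l _.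
  + exact: hD.
  + by rewrite mxE; apply: dhomog0.
  + exact: hE.
  + exact: hD'.
- move=> v; rewrite -[v]hsubmxK mul_row_col; split.
    move=> e.
    have [|w ew] := (colon (rsubmx v)).1.
      by exists (- lsubmx v); rewrite mulNmx; apply/eqP; rewrite -addr_eq0 addrC e.
    have : (lsubmx v - w *m E) *m M = 0.
      have /eqP := eE; rewrite addr_eq0 => /eqP eE'.
      by rewrite mulmxBl -mulmxA eE' mulmxN opprK mulmxA -ew.
    move=> /sD[w' ew']; exists (row_mx w' w).
    rewrite mul_row_col !mul_mx_row mulmx0 add_row_mx add0r -ew' -ew.
    by rewrite subrK.
  move=> [w]; rewrite -[w]hsubmxK mul_row_col !mul_mx_row mulmx0 add_row_mx add0r.
  move=> /eq_row_mx[-> ->]; rewrite mulmxDl -!mulmxA -addrA -mulmxDr eE mulmx0.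
  by rewrite (_ : D *m M = 0) ?mulmx0 ?addr0 //; apply/row_matrixP=> i;
     rewrite row0 row_mul; apply/sD; exists (delta_mx 0 i); rewrite rowE.
(* The new differential is again a cone, of [row_mx D 0] by [row_mx E D']. Its colon condition
   reduces to the syzygies of [D']: if [v *m D' = 0], then [v *m E] is a syzygy of [M], hence in the
   span of [D]. *)
- have [a1 [D1 [hD1 sD1 lD1]]] := lD'.
  apply: (IH 1%N _ _ a1 _ _ _ D1) => //.
  + move=> i j; rewrite /homog_deg mxE; case: splitP => l _; first exact: hD.
    by rewrite mxE; apply: dhomog0.
  + by move=> i j; rewrite /homog_deg mxE; case: splitP => l _; [exact: hE|exact: hD'].
  + have [a2 [D2 [hD2 sD2 lD2]]] := lD; exists a2, D2; split=> //.
    move=> v; rewrite -sD2 mul_mx_row mulmx0; split=> [|->]; last by rewrite row_mx0.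
    by rewrite -[0 in RHS]row_mx0 => /eq_row_mx[].
  + move=> v; rewrite -sD1; split.
      by move=> [u]; rewrite !mul_mx_row mulmx0 => /eq_row_mx[].
    move=> e; have : (v *m E) *m M = 0.
      have /eqP := eE; rewrite addr_eq0 => /eqP eE'.
      by rewrite -mulmxA eE' mulmxN mulmxA e mul0mx oppr0.
    by move=> /sD[w ew]; exists w; rewrite !mul_mx_row mulmx0 e ew.
Qed.

(** Implies [has_linear_resolution], but keeps the recursive form, in which generators can be
    adjoined one at a time. *)
Definition linear_ideal (d : nat) (J : S -> Prop) : Prop :=
  exists (b m : nat) (g : 'cV[S]_b),
    [/\ homog_mx d g, (forall p, J p <-> exists v : 'rV[S]_b, p = (v *m g) 0 0)
      & linear_syzygies m g].

Lemma linear_ideal_eq d (J J' : S -> Prop) :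
  (forall p, J p <-> J' p) -> linear_ideal d J -> linear_ideal d J'.
Proof.
move=> e [b [m [g [hg sg lg]]]]; exists b, m, g; split=> // p.
by rewrite -e.
Qed.

Lemma linear_ideal0 d : linear_ideal d (fun p => p = 0).
Proof.
exists 0%N, 0%N, 0; split=> //; first by case.
move=> p; split=> [->|[v ->]]; first by exists 0; rewrite mulmx0 mxE.
by rewrite mulmx0 mxE.
Qed.

(** [J'] is [J + (u)], and [J' / J] is [S / (J : u)] up to a shift. The generators of the colon
    ideal thus present the new generator modulo the old ones and serve as [D'] in the cone. *)
Lemma linear_ideal_cone d (J J' : S -> Prop) (u : S) :
  homog_deg d u -> linear_ideal d J -> linear_ideal 1 (fun p => J (p * u)) ->
  (forall p, J' p <-> exists q v, J q /\ p = q + v * u) ->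
  linear_ideal d J'.
Proof.
move=> hu [b [m [g [hg sg lg]]]] [b' [m' [h [hh sh lh]]]] eJ'.
pose N := maxn m m'.
exists (b + 1)%N, N.+1, (col_mx g u%:M); split.
- move=> i j; rewrite /homog_deg mxE; case: splitP => k _; first exact: hg.
  by rewrite !ord1 mxE eqxx; apply: hu.
- move=> p; rewrite eJ'; split.
    move=> [q [v [/sg[w ->] ->]]]; exists (row_mx w v%:M).
    by rewrite mul_row_col mul_scalar_mx !mxE eqxx.
  move=> [v ->]; exists ((lsubmx v *m g) 0 0), (rsubmx v 0 0); split.
    by apply/sg; exists (lsubmx v).
  by rewrite -{1}[v]hsubmxK mul_row_col mul_mx_scalar mxE [in RHS]mulrC; congr (_ + _); rewrite mxE.
apply: (@linear_syzygies_cone _ d _ _ _ _ _ _ h) => //.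
- by move=> i j; rewrite !ord1 /homog_deg mxE eqxx; apply: hu.
- by apply: linear_syzygies_leq lg; rewrite leqW // leq_maxl.
- by apply: linear_syzygies_leq lh; rewrite leq_maxr.
move=> v; split.
  move=> [w e]; have [|x ex] := (sh (v 0 0)).1.
    by apply/sg; exists w; rewrite -e mul_mx_scalar mxE mulrC.
  by exists x; apply/rowP=> i; rewrite !ord1.
move=> [w e]; have /sg[x ex] : J (v 0 0 * u).
  by apply/sh; exists w; rewrite e.
by exists x; apply/rowP=> i; rewrite !ord1 -ex mul_mx_scalar mxE mulrC.
Qed.

(** Unrolls the nested existentials into the indexed families that [has_linear_resolution] asks for.
    [D0] is kept apart because its target rank [b] is dictated by [M]. *)
Lemma linear_syzygies_resolution m b c (M : 'M[S]_(b, c)) :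
  linear_syzygies m M ->
  exists (bs : nat -> nat) (D0 : 'M[S]_(bs 0%N, b))
         (D : forall i, 'M[S]_(bs i.+1, bs i)) (l : nat),
    [/\ (b = 0%N \/ bs l = 0%N), homog_mx 1 D0 /\ (forall i, homog_mx 1 (D i)),
        syzygies D0 M, syzygies (D 0%N) D0 & forall i, syzygies (D i.+1) (D i)].
Proof.
elim: m b c M => [|m IH] b c M.
  move=> /= b0; subst b; exists (fun=> 0%N), 0, (fun=> 0), 0%N; split.
  - by right.
  - by split=> // [|?]; case.
  - exact: syzygies0.
  - exact: syzygies0.
  - by move=> i; apply: syzygies0.
move=> [a [D [hD sD /IH[bs [D0 [Ds [l [hl [hD0 hDs] s0 s1 s2]]]]]]]].
pose cs i := if i is i'.+1 then bs i' else a.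
exists cs, D,
  (fun i => match i return 'M_(cs i.+1, cs i) with 0 => D0 | i'.+1 => Ds i' end),
  (if a == 0%N then 0%N else l.+1).
split=> //.
- by right; case: eqP => // ne; case: hl.
- by split=> [//|[|i]]; [exact: hD0|exact: hDs].
- by move=> [|i]; [exact: s1|exact: s2].
Qed.

Lemma linear_ideal_resolution d (J : S -> Prop) :
  linear_ideal d J -> has_linear_resolution J d.
Proof.
move=> [b [m [g [hg sg /linear_syzygies_resolution[bs [D0 [D [l [hl [h0 hD] s0 s1 s2]]]]]]]]].
pose cs i := if i is i'.+1 then bs i' else b.
exists cs, (if b == 0%N then 0%N else l.+1), g,
  (fun i => match i return 'M_(cs i.+1, cs i) with 0 => D0 | i'.+1 => D i' end).
split=> //.
- by case: eqP => // ne; case: hl.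
- by split=> [j|[|i]]; [exact: hg|exact: h0|exact: hD].
- by move=> [|i]; [exact: s1|exact: s2].
Qed.

End LinearResolutions.

(** * Monomial ideals and linear quotients *)

Section MonomialIdeals.
Variables (K : fieldType) (n : nat).
Local Notation S := {mpoly K[n]}.
Implicit Types (P Q : pred 'X_{1..n}) (p q : S).

(** For up-closed [P] this is the monomial ideal whose monomials have exponents in [P]. *)
Definition supp_in P p : Prop := forall m, m \in msupp p -> P m.

Definition up_closed P : Prop :=
  forall m m' : 'X_{1..n}, (m <= m')%MM -> P m -> P m'.

Lemma supp_in0 P : supp_in P 0.
Proof. by move=> m; rewrite msupp0. Qed.

Lemma supp_inD P p q : supp_in P p -> supp_in P q -> supp_in P (p + q).
Proof.
by move=> hp hq m /msuppD_le; rewrite mem_cat => /orP[/hp|/hq].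
Qed.

Lemma supp_in_sum P (I : eqType) (r : seq I) (F : I -> S) :
  (forall i, i \in r -> supp_in P (F i)) -> supp_in P (\sum_(i <- r) F i).
Proof.
move=> h; rewrite big_seq; elim/big_ind: _ => //; first exact: supp_in0.
by move=> p q; apply: supp_inD.
Qed.

Lemma supp_inM P p q : up_closed P -> supp_in P q -> supp_in P (p * q).
Proof.
move=> uP hq m /msuppM_le /allpairsP[[m1 m2] /= [_ /hq h ->]].
by apply: uP h; apply: lem_addl.
Qed.

Lemma supp_inZX P (c : K) m : P m -> supp_in P (c *: 'X_[m]).
Proof. by move=> h m' /msuppZ_le; rewrite msuppX inE => /eqP ->. Qed.

Lemma supp_in_mulX P p a :
  supp_in P (p * 'X_[a]) <-> supp_in (fun m => P (m + a)%MM) p.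
Proof.
split=> h m hm.
  by apply: h; rewrite (perm_mem (msuppMX p a)) addmC; apply: map_f.
by move: hm; rewrite (perm_mem (msuppMX p a)) => /mapP[m' /h + ->]; rewrite addmC.
Qed.

(** Adjoins the monomial ['X_[a]]; on exponents, taking the colon by it is translation by [a]. *)
Lemma linear_ideal_step d P Q a :
  mdeg a = d -> linear_ideal d (supp_in P) ->
  linear_ideal 1 (supp_in (fun m => P (m + a)%MM)) ->
  (forall m, Q m = P m || (a <= m)%MM) -> linear_ideal d (supp_in Q).
Proof.
move=> ha lP lC eQ; apply: (@linear_ideal_cone _ _ d (supp_in P) _ 'X_[a]) => //.
- by rewrite /homog_deg dhomogX; apply/eqP.
- by apply: linear_ideal_eq lC => p; rewrite supp_in_mulX.
move=> p; split=> [h|[q [v [hq ->]]]].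
  (* Split [p] into its monomials in [P] and the others, which are divisible by ['X_[a]]. *)
  exists (\sum_(m <- msupp p | P m) p@_m *: 'X_[m]),
         (\sum_(m <- msupp p | ~~ P m) p@_m *: 'X_[m - a]); split.
    rewrite -big_filter; apply: supp_in_sum => m; rewrite mem_filter => /andP[Pm _].
    exact: supp_inZX.
  rewrite {1}[p]mpolyE (bigID P) /=; congr (_ + _).
  rewrite mulr_suml big_seq_cond [RHS]big_seq_cond; apply: eq_bigr => m /andP[hm nP].
  rewrite -scalerAl -mpolyXD submK //.
  by have := h _ hm; rewrite eQ (negbTE nP).
apply: supp_inD => [m /hq|]; first by rewrite eQ => ->.
by apply/supp_in_mulX => m _; rewrite eQ lem_addl orbT.
Qed.

Lemma supp_in_eq P Q p : P =1 Q -> supp_in P p <-> supp_in Q p.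
Proof. by move=> e; split=> h m /h; rewrite e. Qed.

Lemma linear_ideal_pred0 d : linear_ideal d (supp_in pred0).
Proof.
apply: linear_ideal_eq (linear_ideal0 K n d) => p; split=> [->|h]; first exact: supp_in0.
apply/eqP; rewrite -msupp_eq0; case e: (msupp p) => [//|m s].
by have := h m; rewrite e mem_head => /(_ isT).
Qed.

(** The colon of the ideal of [B] by a variable outside [B] is that ideal itself, so the cones
    assemble a Koszul complex; a repeated variable adds nothing. *)
Lemma linear_ideal_vars (B : seq 'I_n) :
  linear_ideal 1 (supp_in (fun m => has (fun i => 0 < m i)%N B)).
Proof.
elim: B => [|i B IH]; first exact: linear_ideal_pred0.
have [iB|niB] := boolP (i \in B).
  apply: linear_ideal_eq IH => p; apply: supp_in_eq => m /=.
  by case: (ltnP 0 (m i)) => //= hm; apply: (introT hasP); exists i.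
apply: (linear_ideal_step (mdeg1 i) IH) => [|m /=].
  apply: linear_ideal_eq IH => p; apply: supp_in_eq => m /=.
  apply: eq_in_has => j jB; rewrite mnmDE mnm1E (_ : i == j = false) ?addn0 //.
  by apply: contraNF niB => /eqP ->.
rewrite orbC; congr (_ || _); apply/idP/mnm_lepP => [h j|/(_ i)].
  by rewrite mnm1E; case: eqP => // <-.
by rewrite mnm1E eqxx.
Qed.

(** The head is the generator adjoined last. The condition makes the colon of the ideal of [L'] by
    ['X_[a]] generated by variables: each [b] yields a variable [t] that divides [b : a] and carries
    ['X_[a]] into that ideal. *)
Fixpoint linear_quotients (L : seq 'X_{1..n}) : Prop :=
  if L is a :: L' then
    (forall b, b \in L' -> exists t c,
       [/\ c \in L', (a t < b t)%N & (c <= a + U_(t))%MM])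
    /\ linear_quotients L'
  else True.

Lemma linear_quotients_linear d (L : seq 'X_{1..n}) :
  (forall m, m \in L -> mdeg m = d) -> linear_quotients L ->
  linear_ideal d (supp_in (fun m => has (fun u => u <= m)%MM L)).
Proof.
elim: L => [|a L IH] hd; first by move=> _; apply: linear_ideal_pred0.
move=> [hq /IH lL].
have {}lL := lL (fun m hm => hd m (mem_behead (s := a :: L) hm)).
apply: (linear_ideal_step (hd a (mem_head _ _)) lL) => [|m /=]; last exact: orbC.
(* These variables generate the colon ideal. *)
pose B := [seq t <- enum 'I_n | has (fun c => c <= a + U_(t))%MM L].
apply: linear_ideal_eq (linear_ideal_vars B) => p; apply: supp_in_eq => m /=.
apply/hasP/hasP => [[t]|[b bL /mnm_lepP hb]].
  rewrite mem_filter => /andP[/hasP[c cL /mnm_lepP hc] _] mt; exists c => //.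
  apply/mnm_lepP => i; apply: leq_trans (hc i) _.
  rewrite !mnmDE addnC leq_add2r mnm1E; by case: eqP => // <-.
have [t [c [cL lt hc]]] := hq _ bL; exists t.
  by rewrite mem_filter mem_enum andbT; apply/hasP; exists c.
by have := leq_trans lt (hb t); rewrite mnmDE -{1}[a t]add0n ltn_add2r.
Qed.

(** * Generated ideals, powers of monomial primes and degree components, read on exponents *)

Lemma ideal_gen0 (Gen : S -> Prop) : ideal_gen Gen 0.
Proof. by exists [::]; split=> //; rewrite big_nil. Qed.

Lemma ideal_genD (Gen : S -> Prop) p q :
  ideal_gen Gen p -> ideal_gen Gen q -> ideal_gen Gen (p + q).
Proof.
move=> [s [hs ->]] [s' [hs' ->]]; exists (s ++ s'); split; last by rewrite big_cat.
by move=> r; rewrite mem_cat => /orP[/hs|/hs'].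
Qed.

Lemma ideal_genM (Gen : S -> Prop) p q : Gen q -> ideal_gen Gen (p * q).
Proof.
move=> h; exists [:: (p, q)]; split; last by rewrite big_seq1.
by move=> r; rewrite inE => /eqP ->.
Qed.

Lemma ideal_gen_supp (Gen : S -> Prop) p :
  (forall m, m \in msupp p -> exists2 u, Gen 'X_[u] & (u <= m)%MM) -> ideal_gen Gen p.
Proof.
move=> h; rewrite [p]mpolyE big_seq; elim/big_ind: _; first exact: ideal_gen0.
  by move=> q r; apply: ideal_genD.
move=> m /h[u gu um]; rewrite -(submK um) mpolyXD scalerAl.
exact: ideal_genM.
Qed.

Lemma ideal_gen_in_supp (Gen : S -> Prop) P p :
  up_closed P -> (forall q, Gen q -> supp_in P q) -> ideal_gen Gen p -> supp_in P p.
Proof.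
move=> uP h [s [hs ->]]; apply: supp_in_sum => q /hs /h; exact: supp_inM.
Qed.

Definition wdeg (B : {set 'I_n}) (m : 'X_{1..n}) : nat := \sum_(i in B) m i.

Lemma wdegD B m m' : wdeg B (m + m')%MM = (wdeg B m + wdeg B m')%N.
Proof. by rewrite -big_split; apply: eq_bigr => i _; rewrite mnmDE. Qed.

Lemma wdegU B t : wdeg B U_(t)%MM = (t \in B).
Proof.
have [tB|/negbTE ntB] := boolP (t \in B).
  rewrite /wdeg (bigD1 t) //= mnm1E eqxx big1 // => i /andP[_ /negbTE].
  by rewrite mnm1E eq_sym => ->.
rewrite /wdeg big1 // => i iB; rewrite mnm1E; case: eqP => // e.
by rewrite e iB in ntB.
Qed.

Lemma up_closed_wdeg B k : up_closed (fun m => k <= wdeg B m)%N.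
Proof.
move=> m m' /mnm_lepP h le; apply: leq_trans le _; exact: leq_sum.
Qed.

Lemma ideal_pow_primeP (B : {set 'I_n}) k p :
  ideal_pow (Defs.primeP (K := K) B) k p <-> supp_in (fun m => k <= wdeg B m)%N p.
Proof.
elim: k p => [|k IH] p; first by split.
have uB : forall q : S, Defs.primeP B q -> supp_in (fun m => 0 < wdeg B m)%N q.
  move=> q; apply: ideal_gen_in_supp; first exact: up_closed_wdeg.
  by move=> _ [i iB ->] m; rewrite msuppX inE => /eqP ->; rewrite wdegU iB.
split.
  apply: ideal_gen_in_supp; first exact: up_closed_wdeg.
  move=> _ [a [b [/IH ha [/uB hb ->]]]] m /msuppM_le /allpairsP[[m1 m2] /= [h1 h2 ->]].
  by rewrite wdegD -addn1 leq_add //; [apply: ha|apply: hb].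
move=> h; apply: ideal_gen_supp => m /h hm.
(* Positive weight on [B] means that some variable of [B] divides the monomial; splitting it off
   lowers the weight by one. *)
have [i iB mi] : exists2 i, i \in B & (0 < m i)%N.
  apply/exists_inP; apply: contraTT hm; rewrite negb_exists_in => /forall_inP h0.
  rewrite /wdeg big1 // => i /h0; by rewrite -eqn0Ngt => /eqP.
have im : (U_(i) <= m)%MM.
  by apply/mnm_lepP => j; rewrite mnm1E; case: eqP => // <-.
exists m; last exact: lepm_refl.
exists 'X_[m - U_(i)], 'X_i; split; last split.
- apply/IH => m'; rewrite msuppX inE => /eqP ->.
  by move: hm; rewrite -{1}(submK im) wdegD wdegU iB addn1.
- rewrite -['X_i]mul1r; apply: ideal_genM; by exists i.
- by rewrite -mpolyXD submK.
Qed.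

(** A homogeneous element of degree [d] in a monomial ideal is a combination of degree [d] monomials
    of the ideal, and [L] lists these. *)
Lemma ideal_deg_supp (I : S -> Prop) Q d (L : seq 'X_{1..n}) :
  up_closed Q -> (forall p, I p <-> supp_in Q p) ->
  (forall m, (m \in L) = Q m && (mdeg m == d)) ->
  forall p, supp_in (fun m => has (fun u => u <= m)%MM L) p <-> ideal_deg I d p.
Proof.
move=> uQ hI hL p; split.
  move=> h; apply: ideal_gen_supp => m /h /hasP[u uL um]; exists u => //.
  move: uL; rewrite hL => /andP[Qu du]; split; last by rewrite /homog_deg dhomogX.
  by apply/hI => m'; rewrite msuppX inE => /eqP ->.
apply: ideal_gen_in_supp.
  move=> m m' mm' /hasP[u uL um]; apply/hasP; exists u => //.
  apply/mnm_lepP => i; apply: leq_trans (mnm_lepP um i) (mnm_lepP mm' i).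
move=> q [/hI hq /dhomogP hd] m hm; apply/hasP; exists m; last exact: lepm_refl.
by rewrite hL hq //= hd.
Qed.

End MonomialIdeals.

(** * Lexicographic exchange *)

Section LexExchange.
Variables (n : nat) (r : 'I_n -> nat).
Hypothesis r_inj : injective r.
Implicit Types (a b c m : 'X_{1..n}) (A B : {set 'I_n}).

Definition lexlt a b : bool :=
  [exists t, (a t < b t)%N && [forall i, (r i < r t)%N ==> (a i == b i)]].

Lemma lexltP a b :
  reflect (exists2 t, (a t < b t)%N & forall i, (r i < r t)%N -> a i = b i) (lexlt a b).
Proof.
apply: (iffP existsP) => [[t /andP[lt /forallP h]]|[t lt h]]; exists t => //.
  by move=> i /(implyP (h i)) /eqP.
by rewrite lt; apply/forallP => i; apply/implyP => /h ->.
Qed.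

Lemma lexlt_irr a : lexlt a a = false.
Proof. by apply/lexltP => -[t]; rewrite ltnn. Qed.

Lemma lexlt_trans : transitive lexlt.
Proof.
move=> b a c /lexltP[t lt h] /lexltP[u lu h']; apply/lexltP.
case: (ltngtP (r t) (r u)) => [tu|ut|/r_inj e].
- exists t; first by rewrite -(h' _ tu).
  by move=> i it; rewrite h // h' // (ltn_trans it).
- exists u; first by rewrite (h _ ut).
  by move=> i iu; rewrite h ?h' // (ltn_trans iu).
- subst u; exists t; first exact: ltn_trans lt lu.
  by move=> i it; rewrite h ?h'.
Qed.

Lemma lexlt_total a b : a != b -> lexlt a b || lexlt b a.
Proof.
move=> ne; have [t0 ht0] : exists t, a t != b t.
  by apply/existsP; apply: contraNT ne => /existsPn h;
    apply/eqP/mnmP => i; apply/eqP; rewrite -[_ == _]negbK.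
case: (arg_minnP (P := fun t => a t != b t) r ht0) => t ht hmin.
have h i : (r i < r t)%N -> a i = b i.
  by move=> lt; apply/eqP; apply: contraTT lt => /hmin; rewrite -leqNgt.
case: (ltngtP (a t) (b t)) => [lt|lt|e]; last by rewrite e eqxx in ht.
  by apply/orP; left; apply/lexltP; exists t.
by apply/orP; right; apply/lexltP; exists t => // i /h.
Qed.

(** Sort increasingly: the tail after [a] then consists of the lexicographically larger elements, so
    the exchanged [c] lies in it. *)
Lemma linear_quotients_lexsort (s : seq 'X_{1..n}) :
  (forall a b, a \in s -> b \in s -> lexlt a b ->
     exists t c, [/\ c \in s, lexlt a c, (a t < b t)%N & (c <= a + U_(t))%MM]) ->
  exists2 L, L =i s & linear_quotients L.
Proof.
move=> exch; pose le a b := (a == b) || lexlt a b.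
have le_tr : transitive le.
  move=> b a c /orP[/eqP -> //|ab] /orP[/eqP <-|bc]; first by rewrite /le ab orbT.
  by rewrite /le (lexlt_trans ab bc) orbT.
have le_tot : total le.
  move=> a b; rewrite /le; case: eqVneq => //= ne; case/orP: (lexlt_total ne) => -> //.
  by rewrite !orbT.
pose L := sort le (undup s).
have Ls : L =i s by move=> a; rewrite mem_sort mem_undup.
exists L => //.
have : uniq L by rewrite sort_uniq undup_uniq.
have : sorted le L by apply: sort_sorted.
have : {subset L <= s} by move=> a; rewrite Ls.
(* Invariant of the induction: [L] contains every element of [s] above one of its own. *)
have : forall a c, a \in L -> c \in s -> lexlt a c -> c \in L.
  by move=> a c _; rewrite Ls.
elim: L {Ls} => //= a L IH up sub; rewrite path_sortedE // => /andP[/allP ha so] /andP[aL uL].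
have lt_a b : b \in L -> lexlt a b.
  by move=> bL; case/orP: (ha _ bL) => // /eqP e; rewrite e bL in aL.
split.
  move=> b bL; have bs : b \in s by apply: sub; rewrite inE bL orbT.
  have [t [c [cs ac ltab hc]]] := exch a b (sub _ (mem_head _ _)) bs (lt_a _ bL).
  exists t, c; split=> //.
  have := up a c (mem_head _ _) cs ac; rewrite inE => /orP[/eqP e|//].
  by rewrite e lexlt_irr in ac.
apply: IH => // [b c bL cs bc|b bL]; last by apply: sub; rewrite inE bL orbT.
have := up b c; rewrite inE bL orbT => /(_ isT cs bc); rewrite inE => /orP[/eqP e|//].
by have := lexlt_trans (lt_a _ bL) bc; rewrite e lexlt_irr.
Qed.

Lemma wdegC A m : (wdeg A m + wdeg (~: A) m = mdeg m)%N.
Proof.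
rewrite mdegE (bigID (mem A)) /=; congr (_ + _)%N.
by apply: eq_bigl => i; rewrite in_setC.
Qed.

(** If [b] never fell below [a] on [A] after [t], the strict increase at [t] would make its weight
    on [A] larger. *)
Lemma lex_drop A a b t :
  t \in A -> (a t < b t)%N -> (forall i, (r i < r t)%N -> a i = b i) ->
  (wdeg A b <= wdeg A a)%N -> exists s, [/\ s \in A, (r t < r s)%N & (b s < a s)%N].
Proof.
move=> tA lt h; case: (boolP [exists s, [&& s \in A, (r t < r s)%N & (b s < a s)%N]]).
  by move=> /existsP[s /and3P[]]; exists s.
move=> /existsPn no; rewrite leqNgt => /negP[].
rewrite /wdeg (bigD1 t) //= [X in (_ < X)%N](bigD1 t) //= -addSn leq_add //.
apply: leq_sum => i /andP[iA it]; have := no i; rewrite iA /= negb_and -!leqNgt.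
case: (ltngtP (r i) (r t)) => [/h -> //|//|/r_inj e]; by rewrite e eqxx in it.
Qed.

Variables (F : pred {set 'I_n}) (k : {set 'I_n} -> nat).

Hypothesis chain : forall t A B, F A -> F B -> t \in A -> t \in B ->
  (forall x, x \in A -> (r t < r x)%N -> x \in B) \/
  (forall x, x \in B -> (r t < r x)%N -> x \in A).

Definition feasible m : bool := [forall (A | F A), (k A <= wdeg (~: A) m)%N].

(* The sets [A] whose constraint is tight at [a] and which contain [t] form a
   chain beyond [t], so the smallest of them supplies an index [s] common to all;
   then [x_t / x_s] preserves every constraint. *)
Lemma lex_exchange a b :
  feasible a -> feasible b -> mdeg a = mdeg b -> lexlt a b ->
  exists t c, [/\ feasible c, mdeg c = mdeg a, lexlt a c, (a t < b t)%N
                & (c <= a + U_(t))%MM].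
Proof.
move=> /forall_inP fa /forall_inP fb eab /lexltP[t lt h].
pose tight A := [&& F A, t \in A & wdeg (~: A) a == k A].
(* Tightness at [a] and feasibility of [b] compare the weights off [A]; since the degrees agree, [b]
   weighs at most as much as [a] on [A]. *)
have drop A : tight A -> exists s, [/\ s \in A, (r t < r s)%N & (b s < a s)%N].
  move=> /and3P[FA tA /eqP e]; apply: lex_drop lt h _ => //.
  by have := fb _ FA; have := wdegC A a; have := wdegC A b; lia.
have [s [ts as0 hs]] : exists s, [/\ (r t < r s)%N, (0 < a s)%N &
    forall A, tight A -> s \in A].
  (* Without tight constraints any later drop will do, and [lex_drop] on all vertices supplies
     one. *)
  case: (boolP [exists A, tight A]) => [/existsP[A0 tA0]|/existsPn no]; last first.
    have le : (wdeg setT b <= wdeg setT a)%N.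
      have := wdegC setT a; have := wdegC setT b.
      by rewrite /wdeg setCT !big_set0; lia.
    have [s [_ ts bas]] := lex_drop (in_setT t) lt h le.
    exists s; split=> //; first by lia.
    by move=> A; rewrite (negbTE (no A)).
  pose later A := [set x in A | (r t < r x)%N].
  case: (arg_minnP (P := tight) (fun A => #|later A|) tA0) => A tA hmin.
  have [s [sA ts bas]] := drop _ tA; exists s; split=> //; first by lia.
  move=> B tB; have /and3P[FA tmA _] := tA; have /and3P[FB tmB _] := tB.
  have [sub|sub] := chain FA FB tmA tmB; first exact: sub.
  have /eqP e : later B == later A.
    rewrite eqEcard hmin // andbT; apply/subsetP => x; rewrite !inE => /andP[xB tx].
    by rewrite (sub x).
  have : s \in later A by rewrite inE sA.
  by rewrite -e inE => /andP[].
have st : s != t by apply: contraTneq ts => ->; rewrite ltnn.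
have sa : (U_(s) <= a)%MM.
  by apply/mnm_lepP => j; rewrite mnm1E; case: eqP => // <-.
exists t, (a - U_(s) + U_(t))%MM.
(* Stated additively, so that the weight and degree counts avoid truncated subtraction. *)
have ec : (a - U_(s) + U_(t) + U_(s) = a + U_(t))%MM.
  by rewrite -addmA [(U_(t) + _)%MM]addmC addmA submK.
split=> //.
- apply/forall_inP => A FA; have := congr1 (wdeg (~: A)) ec.
  rewrite !(wdegD _ _ U_(_)%MM) !wdegU !in_setC => e.
  (* A constraint loses weight, namely one, only if [t] is in [A] and [s] is not; it is then not
     tight and has one to spare. *)
  have := fa _ FA; have [tA|ntA] := boolP (t \in A); last by rewrite ntA in e; lia.
  have [ti|nti] := boolP (tight A); first by rewrite (hs _ ti) tA in e; lia.
  have : wdeg (~: A) a != k A by apply: contraNN nti => e'; rewrite /tight FA tA.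
  by rewrite tA in e; lia.
- by have := congr1 mdeg ec; rewrite !(mdegD _ U_(_)%MM) !mdeg1; lia.
- apply/lexltP; exists t; first by rewrite mnmDE mnmBE !mnm1E eqxx (negbTE st); lia.
  move=> i it; rewrite mnmDE mnmBE !mnm1E.
  have -> : (s == i) = false by apply: contraTF (ltn_trans it ts) => /eqP ->; rewrite ltnn.
  have -> : (t == i) = false by apply: contraTF it => /eqP ->; rewrite ltnn.
  lia.
- apply/mnm_lepP => i; rewrite !mnmDE mnmBE; lia.
Qed.

Lemma feasible_linear_ideal (K : fieldType) d (I : {mpoly K[n]} -> Prop) :
  (forall p, I p <-> supp_in feasible p) -> linear_ideal d (ideal_deg I d).
Proof.
(* Exponents of degree below [d.+1] form a finite type, so those of degree [d] can be listed. *)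
move=> hI; pose s :=
  [seq m <- map (@bmnm _ _) (enum {: 'X_{1..n < d.+1}}) | feasible m & mdeg m == d].
have hs m : (m \in s) = feasible m && (mdeg m == d).
  rewrite mem_filter; case: (boolP (feasible m && _)) => //= /andP[_ /eqP dm].
  have lt : (mdeg m < d.+1)%N by rewrite dm.
  by apply/mapP; exists (BMultinom lt); rewrite ?mem_enum.
have [a b|L Ls qL] := @linear_quotients_lexsort s.
  rewrite !hs => /andP[fa /eqP da] /andP[fb /eqP db] ab.
  have [|t [c [fc dc ac lt hc]]] := lex_exchange fa fb _ ab; first by rewrite da db.
  by exists t, c; split=> //; rewrite hs fc dc da eqxx.
have dL m : m \in L -> mdeg m = d by rewrite Ls hs => /andP[_ /eqP].
apply: linear_ideal_eq (linear_quotients_linear K dL qL).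
apply: ideal_deg_supp hI _ => [m m' mm' /forall_inP fm|m]; last by rewrite Ls hs.
apply/forall_inP => A /fm; exact: up_closed_wdeg.
Qed.

End LexExchange.

(** * Perfect elimination orderings of chordal graphs *)

Section Chordal.
Variables (n : nat) (H : rel 'I_n).
Hypotheses (Hirr : ssrbool.irreflexive H) (Hsym : ssrbool.symmetric H).
Implicit Types (x y z v w : 'I_n) (W U B : {set 'I_n}).

Fixpoint induced_path x (p : seq 'I_n) : bool :=
  if p is z :: p' then
    [&& H x z, x != z, all (fun w => (x != w) && ~~ H x w) p' & induced_path z p']
  else true.

(** Jump from [x] to the last vertex of the path that equals or neighbours it, discarding what comes
    before. *)
Lemma induced_path_cons x z q :
  induced_path z q -> has (fun w => (x == w) || H x w) (z :: q) ->
  exists q', [/\ induced_path x q', last x q' = last z q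
    & {subset x :: q' <= x :: z :: q}].
Proof.
elim: q z => [|z' q IH] z.
  move=> _ /=; rewrite orbF => h; have [<-|ne] := eqVneq x z.
    by exists [::]; split=> // y; rewrite !inE => ->.
  exists [:: z]; split=> //=.
  by rewrite ne !andbT; move: h; rewrite (negbTE ne).
move=> iz; have /and4P[_ _ _ iz'] := iz.
have [hz' _|nz'] := boolP (has (fun w => (x == w) || H x w) (z' :: q)).
  have [q' [iq' lq' sq']] := IH _ iz' hz'; exists q'; split=> // y /sq'.
  by rewrite !inE => /or3P[] ->; rewrite ?orbT.
rewrite [has _ _]/= -/(has _ (z' :: q)) (negbTE nz') orbF => h.
have [e|ne] := eqVneq x z.
  by exists (z' :: q); split=> //;
    [rewrite e | move=> y; rewrite !inE => /or3P[] ->; rewrite ?orbT].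
exists [:: z, z' & q]; split=> //.
rewrite (negbTE ne) in h; apply/and4P; split=> //.
move: nz'; rewrite -all_predC; apply: sub_all => w /=.
by rewrite negb_or.
Qed.

Lemma path_induced x p : path H x p ->
  exists q, [/\ induced_path x q, last x q = last x p & {subset x :: q <= x :: p}].
Proof.
elim: p x => [|z p IH] x /=; first by exists [::]; split.
move=> /andP[xz /IH[q [iq lq sq]]].
have [|q' [iq' lq' sq']] := @induced_path_cons x z q iq; first by rewrite /= xz orbT.
exists q'; split=> //; first by rewrite lq'.
move=> y /sq'; rewrite inE => /predU1P[->|/sq]; first exact: mem_head.
by rewrite [in X in _ -> X]inE => ->; rewrite orbT.
Qed.

Lemma induced_path_uniq x p : induced_path x p -> uniq (x :: p).
Proof.
elim: p x => //= z p IH x /and4P[_ xz /allP h /IH uz].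
rewrite uz andbT inE negb_or xz /=.
by apply/negP => /h; rewrite eqxx.
Qed.

Lemma induced_path_nth x p i j : induced_path x p -> (i < j <= size p)%N ->
  H (nth x (x :: p) i) (nth x (x :: p) j) = (j == i.+1).
Proof.
elim: p x i j => [|z p IH] x i j; first by move=> _ /= ij; exfalso; lia.
move=> /= /and4P[xz _ /allP h iz]; case: j => // j; case: i => [|i] /= lt.
  case: j lt => [|j] /= lt; first by rewrite xz.
  have /h : nth x p j \in p by apply: mem_nth; rewrite -ltnS.
  by move=> /andP[_ /negbTE ->].
rewrite eqSS -(IH z i j iz) //; congr (H _ _); apply: set_nth_default => /=; lia.
Qed.

(** Otherwise [v] and the path would close up to an induced cycle of length [(size q).+2], which
    exceeds 3. *)
Lemma chordal_cone_path v x q :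
  chordal H -> induced_path x q -> (1 < size q)%N -> v \notin x :: q ->
  ~ (forall z, z \in x :: q -> H v z = (z == x) || (z == last x q)).
Proof.
move=> ch iq sq vq hv; set k := (size q).+2.
pose s := [:: v, x & q]; pose f (i : 'I_k) := nth v s i.
have us : uniq s by rewrite cons_uniq vq induced_path_uniq.
(* The cyclic successor without the modulus: [i.+1], or 0 when [i] is last. *)
have next (i j : 'I_k) : (j == i.+1 %% k :> nat)%N =
    (j == i.+1 :> nat) || (j == 0%N :> nat) && (i.+1 == k).
  have [e|ne] := eqVneq i.+1 k; first by rewrite e modnn andbT; have := ltn_ord j; lia.
  by rewrite andbF orbF modn_small // ltn_neqAle ltn_ord andbT.
have Hv j : (j < (size q).+1)%N -> H v (nth v (x :: q) j) = (j == 0%N) || (j == size q).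
  move=> lt; rewrite hv ?mem_nth //.
  have ux := induced_path_uniq iq.
  rewrite -[X in _ == X]/(nth v (x :: q) 0) nth_uniq //.
  by rewrite (last_nth v) nth_uniq.
have Hq i j : (i < j <= size q)%N -> H (nth v (x :: q) i) (nth v (x :: q) j) = (j == i.+1).
  move=> ij; rewrite -(induced_path_nth iq ij).
  by congr (H _ _); apply: set_nth_default => /=; lia.
apply: (ch k f); first by rewrite /k; lia.
split=> [i j /eqP|i j].
  by rewrite nth_uniq ?ltn_ord // => /eqP /val_inj.
rewrite !next /f; case: i j => [[|i] ilt] [[|j] jlt] /=.
- by rewrite Hirr /k; lia.
- by rewrite Hv /k; lia.
- by rewrite Hsym Hv /k; lia.
- case: (ltngtP i j) => ij.
  + by rewrite Hq /k; lia.
  + by rewrite Hsym Hq /k; lia.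
  + by rewrite ij Hirr /k; lia.
Qed.

Definition induced_rel U : rel 'I_n := [rel u w | [&& u \in U, w \in U & H u w]].

Lemma induced_rel_connect_sym U : connect_sym (induced_rel U).
Proof. by apply: sym_connect_sym => x y; rewrite /induced_rel /= Hsym andbCA. Qed.

Lemma connect_induced_mem U x y : x \in U -> connect (induced_rel U) x y -> y \in U.
Proof.
move=> + /connectP[p + ->]; elim: p x => //= z p IH x _ /andP[/and3P[_ zU _]].
exact: IH.
Qed.

(** If [x] and [y] were not adjacent, an induced path between them through [U] would have at least
    two edges, and [v] sees only its ends. *)
Lemma chordal_separator v x y w1 w2 U :
  chordal H -> H v x -> H v y -> x != y -> w1 \in U ->
  connect (induced_rel U) w1 w2 -> H x w1 -> H y w2 ->
  (forall u, u \in U -> (u != v) && ~~ H v u) -> H x y.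
Proof.
move=> ch vx vy xy w1U /connectP[p pp ew2] xw1 yw2 hU.
apply: contraTT isT => nxy.
have sub : subrel (induced_rel U) H by move=> a b /and3P[].
have pU : {subset w1 :: p <= U}.
  move=> z; rewrite inE => /predU1P[-> //|].
  elim: p (w1) w1U pp {ew2} => //= a p IH b bU /andP[/and3P[_ aU _] pp].
  by rewrite inE => /predU1P[-> //|]; apply: IH pp.
have pxy : path H x (w1 :: rcons p y).
  by rewrite /= xw1 rcons_path (sub_path sub pp) -ew2 Hsym yw2.
have [q [iq lq sq]] := path_induced pxy.
rewrite /= last_rcons in lq.
have hq z : z \in x :: q -> [\/ z = x, z = y | z \in U].
  move=> /sq; rewrite inE -rcons_cons mem_rcons inE => /or3P[/eqP|/eqP|/pU].
  + by constructor 1.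
  + by constructor 2.
  + by constructor 3.
have vx' : v != x by apply: contraTneq vx => ->; rewrite Hirr.
have vy' : v != y by apply: contraTneq vy => ->; rewrite Hirr.
exfalso; apply: (@chordal_cone_path v x q) => //.
- case: q iq lq {sq hq} => [|a [|b q]] //=; first by move=> _ e; rewrite e eqxx in xy.
  by move=> /andP[xa _] e; rewrite -e xa in nxy.
- apply/negP => /hq[/eqP|/eqP|/hU]; rewrite ?(negbTE vx') ?(negbTE vy') //.
  by rewrite eqxx.
- move=> z /hq; rewrite lq => -[->|->|zU]; rewrite ?eqxx ?orbT //.
  have /andP[_ /negbTE nvz] := hU _ zU; rewrite nvz; symmetry.
  by apply/norP; split; apply: contraFneq nvz => ->.
Qed.

Definition simplicial W s : bool :=
  (s \in W) && [forall (x | (x \in W) && H s x),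
    forall (y | (y \in W) && H s y), (x != y) ==> H x y].

Lemma simplicialP W s :
  reflect (s \in W /\ forall x y, x \in W -> y \in W -> H s x -> H s y -> x != y -> H x y)
    (simplicial W s).
Proof.
apply: (iffP andP) => -[sW h]; split=> //.
  move=> x y xW yW sx sy xy; have /forall_inP/(_ x) := h; rewrite xW => /(_ sx).
  by move=> /forall_inP/(_ y); rewrite yW xy => /(_ sy).
apply/forall_inP => x /andP[xW sx]; apply/forall_inP => y /andP[yW sy].
by apply/implyP; apply: h.
Qed.

(* Dirac's theorem.  Let C be the component of w in the subgraph of
   non-neighbours of v, and N its boundary in W.  N is a clique, by
   [chordal_separator], so induction on C :|: N yields a simplicial vertex in C. *)
Lemma chordal_simplicial_aux W : chordal H ->
  (W != set0 -> exists s, simplicial W s) /\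
  (forall v w, v \in W -> w \in W -> w != v -> ~~ H v w ->
     exists s, [/\ simplicial W s, s != v & ~~ H v s]).
Proof.
move=> ch; have [m] := ubnP #|W|; elim: m W => // m IH W; rewrite ltnS => Wm.
have nonadj v w : v \in W -> w \in W -> w != v -> ~~ H v w ->
    exists s, [/\ simplicial W s, s != v & ~~ H v s].
  move=> vW wW wv nvw.
  pose U := [set u in W | (u != v) && ~~ H v u].
  pose C := [set u | connect (induced_rel U) w u].
  pose N := [set s in W | (s \notin C) && [exists u in C, H s u]].
  have wU : w \in U by rewrite inE wW wv.
  have CU u : u \in C -> u \in U by rewrite inE; apply: connect_induced_mem.
  have CW u : u \in C -> u \in W by move=> /CU; rewrite inE => /andP[].
  have UH u : u \in U -> (u != v) && ~~ H v u by rewrite inE => /andP[].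
  have wC : w \in C by rewrite inE connect0.
  have vC : v \notin C by apply/negP => /CU /UH; rewrite eqxx.
  have NP s : s \in N -> [/\ s \in W, s \notin C & exists2 u, u \in C & H s u].
    by rewrite inE => /and3P[sW sC /exists_inP[u uC su]]; split=> //; exists u.
  have vN s : s \in N -> H v s.
    move=> /NP[sW sC [u uC su]]; apply: contraNT sC => nvs.
    have sv : s != v.
      by apply: contraTneq su => ->; have /andP[] := UH _ (CU _ uC).
    rewrite inE; apply: (@connect_trans _ _ u); first by rewrite inE in uC.
    apply: connect1; apply/and3P; split; first exact: CU.
      by rewrite inE sW sv.
    by rewrite Hsym.
  have Nclique s s' : s \in N -> s' \in N -> s != s' -> H s s'.
    move=> sN s'N; have [_ _ [u uC su]] := NP _ sN; have [_ _ [u' u'C su']] := NP _ s'N.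
    move=> ss'; apply: (chordal_separator ch (vN _ sN) (vN _ s'N) ss' (CU _ uC) _ su su' UH).
    apply: (@connect_trans _ _ w); last by rewrite inE in u'C.
    by rewrite induced_rel_connect_sym; rewrite inE in uC.
  have sub_lt B : {subset B <= W} -> v \notin B -> (#|B| < m)%N.
    move=> BW vB; apply: leq_trans Wm; apply: proper_card; apply/properP.
    by split; [apply/subsetP | exists v].
  have CNW u : u \in C :|: N -> u \in W by rewrite inE => /orP[/CW|/NP[]].
  have vCN : v \notin C :|: N.
    by rewrite inE (negbTE vC); apply/negP => /vN; rewrite Hirr.
  (* All neighbours in [W] of a vertex of [C] lie in [C :|: N], so simpliciality there passes to
     [W]. *)
  suff [s sC /simplicialP[_ ss]] : exists2 s, s \in C & simplicial (C :|: N) s.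
    have /andP[sv nvs] := UH _ (CU _ sC); exists s; split=> //.
    apply/simplicialP; split=> [|x y xW yW sx sy]; first exact: CW.
    have mem z : z \in W -> H s z -> z \in C :|: N.
      move=> zW sz; rewrite in_setU; have [//|nzC] := boolP (z \in C).
      by rewrite inE zW nzC; apply/exists_inP; exists s; rewrite // Hsym.
    exact: ss (mem _ xW sx) (mem _ yW sy) sx sy.
  (* If some [s0] in [N] misses a vertex of [C :|: N], induction gives a simplicial vertex not
     adjacent to [s0]; it avoids the clique [N], so it is in [C]. *)
  have [ex|nex] := boolP [exists s0 in N, exists (u0 | (u0 \in C :|: N) && (u0 != s0)), ~~ H s0 u0].
    have /exists_inP[s0 s0N /exists_inP[u0 /andP[u0CN us0] ns0u0]] := ex.
    have s0CN : s0 \in C :|: N by rewrite inE s0N orbT.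
    have [_ /(_ s0 u0 s0CN u0CN us0 ns0u0)[s [ss ss0 ns0s]]] := IH _ (sub_lt _ CNW vCN).
    exists s => //; have /simplicialP[] := ss; rewrite inE => /orP[//|sN] _.
    by rewrite (Nclique _ _ s0N sN) // eq_sym in ns0s.
  have full s0 u0 : s0 \in N -> u0 \in C :|: N -> u0 != s0 -> H s0 u0.
    move=> s0N u0CN us; apply: contraNT nex => nH.
    by apply/exists_inP; exists s0 => //; apply/exists_inP; exists u0; rewrite ?u0CN.
  (* Now vertices of [N] are adjacent to everything else in [C :|: N], so a simplicial vertex of [C]
     alone stays simplicial. *)
  have [+ _] := IH _ (sub_lt C CW vC).
  case; first by apply/set0Pn; exists w.
  move=> s /simplicialP[sC ss]; exists s => //; apply/simplicialP.
  split=> [|x y xCN yCN sx sy xy]; first by rewrite inE sC.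
  move: (xCN) (yCN); rewrite !in_setU => /orP[xC|xN] /orP[yC|yN].
  - exact: ss.
  - by rewrite Hsym; apply: full.
  - by apply: full => //; rewrite eq_sym.
  - exact: Nclique.
split=> // /set0Pn[v0 v0W].
(* Either [W] has a non-adjacent pair and [nonadj] applies, or [W] is a clique and any vertex
   works. *)
have [ex|nex] := boolP [exists v in W, exists (w | (w \in W) && (w != v)), ~~ H v w].
  have /exists_inP[v vW /exists_inP[w /andP[wW wv] nvw]] := ex.
  by have [s []] := nonadj v w vW wW wv nvw; exists s.
exists v0; apply/simplicialP; split=> // x y xW yW _ _ xy.
apply: contraNT nex => nxy; apply/exists_inP; exists x => //.
by apply/exists_inP; exists y; rewrite // yW eq_sym.
Qed.

Definition elimination_rank (r : 'I_n -> nat) : Prop :=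
  injective r /\ forall t x y, (r t < r x)%N -> (r t < r y)%N ->
    H t x -> H t y -> x != y -> H x y.

Lemma chordal_elimination : chordal H -> exists r, elimination_rank r.
Proof.
move=> ch; suff [r [r_inj hr]] : exists r : 'I_n -> nat, {in setT &, injective r} /\
    forall t x y, t \in setT -> x \in setT -> y \in setT ->
      (r t < r x)%N -> (r t < r y)%N -> H t x -> H t y -> x != y -> H x y.
  exists r; split=> [x y|t x y]; first by apply: r_inj; rewrite !inE.
  by apply: hr; rewrite !inE.
have [m] := ubnP #|[set: 'I_n]|; elim: m [set: 'I_n] => // m IH W; rewrite ltnS => Wm.
have [->|W0] := eqVneq W set0.
  by exists (@nat_of_ord n); split=> [x y|t x y]; rewrite inE.
have [/(_ W0)[s /simplicialP[sW ss]] _] := chordal_simplicial_aux W ch.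
have [|r [r_inj hr]] := IH (W :\ s).
  by apply: leq_trans Wm; rewrite (cardsD1 s W) sW.
(* The simplicial vertex is ranked first; the shift keeps the remaining order. *)
pose r' x := if x == s then 0%N else (r x).+1; exists r'; split.
  move=> x y xW yW; rewrite /r'; case: (eqVneq x s) => [->|xs]; case: (eqVneq y s) => [->|ys] //.
  by move=> [] /r_inj; apply; rewrite !inE ?xs ?ys.
move=> t x y tW xW yW; rewrite /r'; case: (eqVneq x s) => // xs; case: (eqVneq y s) => // ys.
case: (eqVneq t s) => [->|ts]; first by move=> _ _; apply: ss.
by rewrite !ltnS; apply: hr; rewrite !inE ?xs ?ys ?ts.
Qed.

End Chordal.

(** * Block graphs *)

Section BlockGraphs.
Variables (n : nat) (H : rel 'I_n).
Hypothesis Hsym : ssrbool.symmetric H.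
Implicit Types A B C : {set 'I_n}.

Lemma cliqueP A :
  reflect (forall x y, x \in A -> y \in A -> x != y -> H x y) (clique H A).
Proof.
apply: (iffP forall_inP) => [h x y xA yA xy|h x xA].
  by have /forall_inP/(_ y yA)/implyP := h x xA; apply.
by apply/forall_inP => y yA; apply/implyP; apply: h.
Qed.

Lemma induced_connectedP A :
  reflect {in A &, forall x y, connect (induced_rel H A) x y} (induced_connected H A).
Proof.
apply: (iffP forall_inP) => [h x y xA yA|h x xA].
  by have /forall_inP := h x xA; apply.
by apply/forall_inP => y; apply: h.
Qed.

Lemma clique_connected A : clique H A -> induced_connected H A.
Proof.
move=> /cliqueP cA; apply/induced_connectedP => x y xA yA.
have [->|xy] := eqVneq x y; first exact: connect0.
by apply: connect1; apply/and3P; split=> //; apply: cA.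
Qed.

Lemma induced_connectedU A B z : z \in A -> z \in B ->
  induced_connected H A -> induced_connected H B -> induced_connected H (A :|: B).
Proof.
move=> zA zB /induced_connectedP cA /induced_connectedP cB.
have mono C : C \subset A :|: B ->
    subrel (connect (induced_rel H C)) (connect (induced_rel H (A :|: B))).
  move=> /subsetP CAB; apply: connect_sub => x y /and3P[xC yC xy].
  by apply: connect1; apply/and3P; split=> //; apply: CAB.
have toz x : x \in A :|: B -> connect (induced_rel H (A :|: B)) x z.
  rewrite inE => /orP[xA|xB]; first by apply: (mono A); rewrite ?subsetUl ?cA.
  by apply: (mono B); rewrite ?subsetUr ?cB.
apply/induced_connectedP => x y xAB yAB; apply: (connect_trans (toz _ xAB)).
by rewrite induced_rel_connect_sym // toz.
Qed.

(** A nonempty biconnected set extends to a block, and cliques pass to subsets. *)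
Lemma biconn_clique B : block_graph H -> biconn H B -> clique H B.
Proof.
move=> bg bB; have [->|/set0Pn[b bB0]] := eqVneq B set0.
  by apply/cliqueP => x y; rewrite inE.
have [C mC BC] := maxset_exists (P := biconn H) bB.
have /cliqueP cC : clique H C.
  apply: bg; apply/and3P; split; last 1 first.
  - apply/forallP => D; apply/implyP => CD; apply/negP => bD.
    have := maxsetsup mC bD (proper_sub CD) => e; by rewrite e properxx in CD.
  - by apply/set0Pn; exists b; apply: (subsetP BC).
  - exact: maxsetp mC.
by apply/cliqueP => x y xB yB; apply: cC; apply: (subsetP BC).
Qed.

(** Deleting one vertex leaves a common vertex of the two cliques, so their union is biconnected. *)
Lemma block_graph_cliqueU A B x y : block_graph H -> clique H A -> clique H B ->
  x != y -> x \in A -> y \in A -> x \in B -> y \in B -> clique H (A :|: B).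
Proof.
move=> bg cA cB xy xA yA xB yB; apply: biconn_clique => //; apply/andP; split.
  by apply: (@induced_connectedU _ _ x) => //; apply: clique_connected.
apply/forall_inP => v _; rewrite setDUl.
have cD C : clique H C -> induced_connected H (C :\ v).
  move=> /cliqueP cC; apply: clique_connected; apply/cliqueP => a b.
  by rewrite !inE => /andP[_ aC] /andP[_ bC]; apply: cC.
have [z [zv zA zB]] : exists z, [/\ z != v, z \in A & z \in B].
  by have [<-|] := eqVneq x v; [exists y; rewrite eq_sym | exists x].
by apply: (@induced_connectedU _ _ z); rewrite ?cD // !inE zv.
Qed.

(** An induced cycle is biconnected, hence would be a clique, but its vertices 0 and 2 are not
    adjacent. *)
Lemma block_graph_chordal : block_graph H -> chordal H.
Proof.
move=> bg [//|k] f k3 [f_inj fH].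
(* [g i] walks round the cycle from [f i]; both the whole cycle and the cycle minus a vertex are
   initial stretches of such walks. *)
pose g i a := f (inord ((i + a) %% k.+1)).
have gH i a : H (g i a) (g i a.+1).
  rewrite /g fH !inordK ?ltn_mod //; apply/orP; left.
  by rewrite -[((i + a) %% k.+1).+1]addn1 modnDml addn1 addnS.
have gconn i (D : {set 'I_n}) m : (forall a, (a <= m)%N -> g i a \in D) ->
    forall a, (a <= m)%N -> connect (induced_rel H D) (g i 0%N) (g i a).
  move=> gD; elim=> [|a IH] am; first exact: connect0.
  apply: connect_trans (IH (ltnW am)) (connect1 _).
  by apply/and3P; split; [apply: gD (ltnW am)|apply: gD|].
have gsurj i j : exists2 a, (a <= k)%N & f j = g i a.
  exists ((j + (k.+1 - i %% k.+1)) %% k.+1)%N; first by rewrite -ltnS ltn_mod.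
  rewrite /g modnDmr -modnDml addnCA subnKC; last by rewrite ltnW // ltn_mod.
  by rewrite modnDr modn_small // inord_val.
have conn i (D : {set 'I_n}) m : (forall a, (a <= m)%N -> g i a \in D) ->
    (forall z, z \in D -> exists2 a, (a <= m)%N & z = g i a) -> induced_connected H D.
  move=> gD Dg; apply/induced_connectedP => x y /Dg[a am ->] /Dg[b bm ->].
  apply: (@connect_trans _ _ (g i 0%N)); last exact: gconn gD _ bm.
  by rewrite induced_rel_connect_sym //; apply: gconn gD _ am.
pose B := [set f i | i : 'I_k.+1].
have gB i a : g i a \in B by apply: imset_f.
have bB : biconn H B.
  apply/andP; split.
    apply: (conn 0%N _ k) => // z /imsetP[j _ ->]; exact: gsurj.
  apply/forall_inP => _ /imsetP[i0 _ ->].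
  have g0 : g i0 0%N = f i0 by rewrite /g addn0 modn_small // inord_val.
  have gS a : g i0.+1 a = g i0 a.+1 by rewrite /g addSnnS.
  apply: (conn i0.+1 _ k.-1) => [a ak|z].
    rewrite gS in_setD1 gB andbT -g0; apply/eqP => /f_inj /(congr1 val) /=.
    rewrite !inordK ?ltn_mod // => /eqP; rewrite eqn_modDl mod0n modn_small //.
    by move: ak k3; lia.
  rewrite in_setD1 => /andP[zi /imsetP[j _ ez]]; subst z.
  have [[|a] ak e] := gsurj i0 j; first by rewrite e g0 eqxx in zi.
  by exists a; [move: ak k3; lia | rewrite gS].
have := biconn_clique bg bB.
pose i2 : 'I_k.+1 := inord 2.
move=> /cliqueP/(_ (f ord0) (f i2) (imset_f _ isT) (imset_f _ isT)).
have i2E : i2 = 2%N :> nat by rewrite inordK //; apply: ltnW.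
rewrite fH i2E (inj_eq f_inj) -val_eqE /= i2E !modn_small //; last by move: k3; lia.
by move=> /(_ isT).
Qed.

End BlockGraphs.

(** * Good vertex orderings *)

Section Facets.
Variables (n : nat) (G : rel 'I_n).
Hypothesis sG : simple_graph G.
Local Notation H := (compl_graph G).
Implicit Types A B C : {set 'I_n}.

Lemma compl_graph_irr : ssrbool.irreflexive H.
Proof. by move=> x; rewrite /compl_graph eqxx. Qed.

Lemma compl_graph_sym : ssrbool.symmetric H.
Proof. by move=> x y; rewrite /compl_graph eq_sym (proj2 sG). Qed.

Lemma independentE A : independent G A = clique H A.
Proof.
apply/forall_inP/cliqueP => [h x y xA yA xy|h x xA].
  by rewrite /compl_graph xy; have /forall_inP := h x xA; apply.
apply/forall_inP => y yA; have [<-|xy] := eqVneq x y; first by rewrite (proj1 sG).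
by have := h x y xA yA xy; rewrite /compl_graph xy.
Qed.

Lemma facet_clique A x y : facet G A -> x \in A -> y \in A -> x != y -> H x y.
Proof. by rewrite /facet independentE => /andP[/cliqueP h _]; apply: h. Qed.

Lemma facet_sup A C : facet G A -> clique H C -> A \subset C -> C = A.
Proof.
move=> /andP[_ /forallP/(_ C)/implyP h] cC sAC; apply/eqP; rewrite eqEsubset sAC andbT.
by apply: contraTT cC => nCA; rewrite -independentE h // properE sAC.
Qed.

Lemma facet_mem A y : facet G A -> (forall z, z \in A -> z != y -> H y z) -> y \in A.
Proof.
move=> fA h; suff <- : y |: A = A by rewrite setU11.
apply: facet_sup => //; last exact: subsetUr.
apply/cliqueP => a b; rewrite !inE => /predU1P[->|aA] /predU1P[->|bA] ab.
- by rewrite eqxx in ab.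
- by apply: h; rewrite // eq_sym.
- by rewrite compl_graph_sym; apply: h.
- exact: facet_clique fA _ _ _.
Qed.

Lemma facet_exists C : clique H C -> exists2 A, facet G A & C \subset A.
Proof.
move=> cC; have [A mA CA] := maxset_exists (P := clique H) cC; exists A => //.
apply/andP; split; first by rewrite independentE; apply: maxsetp mA.
apply/forallP => B; apply/implyP => AB; rewrite independentE; apply/negP => cB.
by have e := maxsetsup mA cB (proper_sub AB); rewrite e properxx in AB.
Qed.

Definition facet_chain (r : 'I_n -> nat) : Prop :=
  forall t A B, facet G A -> facet G B -> t \in A -> t \in B ->
  (forall x, x \in A -> (r t < r x)%N -> x \in B) \/
  (forall x, x \in B -> (r t < r x)%N -> x \in A).

(** The later neighbours of [t], together with [t], form a clique, which extends to a facet. *)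
Lemma elimination_facet r t : elimination_rank H r ->
  exists2 A, facet G A & t \in A /\ forall x, H t x -> (r t < r x)%N -> x \in A.
Proof.
move=> [r_inj hr]; pose C := [set x | (x == t) || (H t x && (r t < r x)%N)].
have [|A fA /subsetP CA] := @facet_exists C.
  apply/cliqueP => x y; rewrite !inE.
  move=> /predU1P[->|/andP[tx rx]] /predU1P[->|/andP[ty ry]] xy //.
  - by rewrite eqxx in xy.
  - by rewrite compl_graph_sym.
  - exact: hr rx ry tx ty xy.
exists A => //; split=> [|x tx rx]; first by apply: CA; rewrite inE eqxx.
by apply: CA; rewrite inE tx rx orbT.
Qed.

Lemma facet_later A r t x : facet G A -> t \in A -> x \in A -> (r t < r x)%N -> H t x.
Proof.
move=> fA tA xA lt; apply: facet_clique fA tA xA _.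
by apply: contraTneq lt => ->; rewrite ltnn.
Qed.

Lemma block_graph_facet_chain r :
  block_graph H -> elimination_rank H r -> facet_chain r.
Proof.
move=> bg er t A B fA fB tA tB.
have [/exists_inP[x xA rx]|no] := boolP [exists x in A, (r t < r x)%N]; last first.
  left=> x xA rx; case/negP: no; by apply/exists_inP; exists x.
right=> y yB ry; have [A0 fA0 [tA0 hA0]] := elimination_facet t er.
have cl C : facet G C -> clique H C by rewrite /facet independentE => /andP[].
have tx : t != x by apply: contraTneq rx => ->; rewrite ltnn.
have xA0 := hA0 _ (facet_later fA tA xA rx) rx.
(* [A] and [A0] share [t] and [x], so their union is a clique; by maximality [A] contains [A0],
   hence all later neighbours of [t]. *)
have cU := block_graph_cliqueU compl_graph_sym bg (cl _ fA) (cl _ fA0) tx tA xA tA0 xA0.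
rewrite -(facet_sup fA cU (subsetUl _ _)) inE; apply/orP; right.
exact: hA0 (facet_later fB tB yB ry) ry.
Qed.

(** Distinct [A] and [B] are the only facets through [t], so one of them is the facet containing all
    later neighbours of [t]. *)
Lemma two_facets_chain r :
  (forall x, (#|[set A : {set 'I_n} | facet G A & x \in A]| <= 2)%N) ->
  elimination_rank H r -> facet_chain r.
Proof.
move=> two er t A B fA fB tA tB; have [<-|AB] := eqVneq A B; first by left.
have [A0 fA0 [tA0 hA0]] := elimination_facet t er.
have /eqP e : [set A; B] == [set A : {set 'I_n} | facet G A & t \in A].
  rewrite eqEcard cards2 AB two andbT; apply/subsetP => C.
  by rewrite !inE => /orP[] /eqP ->; apply/andP.
have : A0 \in [set A; B] by rewrite e inE fA0.
rewrite !inE => /orP[] /eqP e0; rewrite {}e0 in hA0.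
  by right=> x xB rx; apply: hA0 (facet_later fB tB xB rx) rx.
by left=> x xA rx; apply: hA0 (facet_later fA tA xA rx) rx.
Qed.

Lemma proper_interval_facet_chain : proper_interval H ->
  exists2 r : 'I_n -> nat, injective r & facet_chain r.
Proof.
move=> [s hs]; pose r x : nat := (s^-1%g) x.
have hr x y z : (r x < r y)%N -> (r y < r z)%N -> H x z -> H x y && H y z.
  by move=> xy yz xz; have := hs _ _ _ xy yz; rewrite !permKV; apply.
exists r; first by move=> x y /val_inj /perm_inj.
(* Facets are intervals: a member [z] before [y] is compared with [x], one after [y] with [t], and
   maximality puts [y] in [A]. *)
have mid A t y x : facet G A -> t \in A -> x \in A -> (r t < r y)%N -> (r y < r x)%N -> y \in A.
  move=> fA tA xA ty yx; apply: facet_mem => // z zA zy.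
  case: (ltngtP (r z) (r y)) => [zy'|yz|/val_inj/perm_inj e]; last by rewrite e eqxx in zy.
    have zx := ltn_trans zy' yx.
    have /andP[] := hr _ _ _ zy' yx (facet_later fA zA xA zx).
    by rewrite compl_graph_sym.
  by have /andP[] := hr _ _ _ ty yz (facet_later fA tA zA (ltn_trans ty yz)).
move=> t A B fA fB tA tB.
have [/forall_inP h|] := boolP [forall (x | (x \in A) && (r t < r x)%N), x \in B].
  by left=> x xA rx; apply: h; rewrite xA.
(* [B] misses [x], so as an interval through [t] it ends before [x], and its later vertices lie
   between [t] and [x], inside [A]. *)
move=> /forall_inPn[x /andP[xA rx] xB]; right=> y yB ry.
case: (ltngtP (r y) (r x)) => [yx|xy|/val_inj/perm_inj e].
- exact: mid fA tA xA ry yx.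
- by rewrite (mid _ _ _ _ fB tB yB rx xy) in xB.
- by rewrite -e yB in xB.
Qed.

Lemma facet_intersection_linear (K : fieldType) (r : 'I_n -> nat) k :
  injective r -> facet_chain r ->
  componentwise_linear (facet_intersection (K := K) G k).
Proof.
move=> r_inj ch d; apply: linear_ideal_resolution.
apply: (feasible_linear_ideal r_inj (F := facet G) (k := k)) => // p; split.
  by move=> h m hm; apply/forall_inP => A /h /ideal_pow_primeP; apply.
by move=> h A fA; apply/ideal_pow_primeP => m /h /forall_inP; apply.
Qed.

End Facets.

Theorem theorem2p3 (K : fieldType) (n : nat) (G : rel 'I_n) :
  simple_graph G ->
  [\/ block_graph (compl_graph G),
      proper_interval (compl_graph G)
    | cochordal G /\
      (forall x : 'I_n, (#|[set A : {set 'I_n} | facet G A & x \in A]| <= 2)%N)] ->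
  (forall k : {set 'I_n} -> nat,
     (forall A, facet G A -> (0 < k A)%N) ->
     componentwise_linear (facet_intersection (K := K) G k)) /\
  (forall k : nat, (1 <= k)%N ->
     componentwise_linear (symbolic_power (K := K) G k)).
Proof.
move=> sG hG; suff [r r_inj ch] : exists2 r : 'I_n -> nat, injective r & facet_chain G r.
  by split=> k _; apply: facet_intersection_linear r_inj ch.
have irr := @compl_graph_irr n G; have sym := compl_graph_sym sG.
case: hG => [bg|pi|[ch two]]; last 1 first.
- have [r er] := chordal_elimination irr sym ch.
  by exists r; [exact: (proj1 er) | apply: two_facets_chain er].
- have [r er] := chordal_elimination irr sym (block_graph_chordal sym bg).
  by exists r; [exact: (proj1 er) | apply: block_graph_facet_chain er].
- exact: proper_interval_facet_chain.
Qed.
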